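(* Let $m=\binom{n+d}{d}$ and let $\mathcal{L}=\sum_{|\alpha|=0}^np_\alpha(x)\partial^\alpha$ on $\Omega=\mathbb{T}^d$ with coefficients $p_\alpha\in C^{mn}(\Omega)$. Let the initial condition be $$u_0(x)=\sum_{j=1}^rw_je^{i\zeta_j\cdot x},$$ where $r>\binom{mn+d}{d}$, the vectors $\zeta_1,\dots,\zeta_r\in\mathbb{Z}^d$ do not all lie on an algebraic hypersurface of degree at most $mn$, and the weights $w_j$ are random variables with $w_j\sim\mathcal{U}[a_j,b_j]$, $a_j<b_j$. Let $\mathbb{P}$ be the induced probability measure on $\Omega\times\prod_{j=1}^r[a_j,b_j]$. If $\sum_{\alpha\in D_n}|p_\alpha(x)|^2\ne0$ for almost every $x\in\Omega$, then the $m\times m$ matrix $S=(S_{k,\alpha})$, $S_{k,\alpha}(x):=\partial^\alpha\mathcal{L}^{k-1}u_0(x)$ ($k=1,\dots,m$, $|\alpha|\le n$), is non-singular $\mathbb{P}$-almost surely.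
   Context: $\Omega=\mathbb{T}^d=\mathbb{R}^d/(2\pi\mathbb{Z})^d$; the $p_\alpha$ are real-valued periodic functions. The diagonal multi-index set is $D_n=\{\alpha=(\alpha_1,\dots,\alpha_d):|\alpha|=n\text{ and there exists }1\le j\le d\text{ with }\alpha_j=n\}$. $\mathcal{U}[a,b]$ is the uniform distribution on $[a,b]$. The measure $\mathbb{P}$ is the product of normalized Lebesgue measure in $x\in\Omega$ and the uniform distributions of the $w_j$. ''Not on an algebraic hypersurface of degree at most $mn$'' means no nonzero polynomial of degree at most $mn$ vanishes at all of $\zeta_1,\dots,\zeta_r$. *)

(* Defs.v *)
From HB Require Import structures.
From mathcomp Require Import all_boot all_order all_algebra complex.

Set Implicit Arguments.
Unset Strict Implicit.
Unset Printing Implicit Defensive.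

(* Multi-indices and polynomials come from multinomials. The library is imported
   inside a module because its notations clash with those of MathComp-Analysis. *)
Module MultiIndex.
From mathcomp Require Import mpoly.
Import GRing.Theory.
Local Open Scope ring_scope.

Definition mindex (d n : nat) : finType := 'X_{1..d < n.+1}.

Definition mcomp (d n : nat) (alpha : mindex d n) (j : 'I_d) : nat :=
  (alpha : 'X_{1..d}) j.

Definition mlen (d n : nat) (alpha : mindex d n) : nat := mdeg alpha.

Lemma card_mindex (d n : nat) : #|mindex d n| = 'C(n + d, d).
Proof.
rewrite addnC -card_partial_ord_partitions -!sum1_card.
pose f (t : d.-tuple 'I_n.+1) : 'X_{1..d} := [multinom (tnth t i : nat) | i < d].
have mf t : mdeg (f t) = (\sum_(i <- t) i)%N.
  by rewrite mdegE big_tuple; apply: eq_bigr => i _; rewrite mnmE.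
pose g (t : d.-tuple 'I_n.+1) : mindex d n := insubd (bm0 : mindex d n) (f t).
have gE (t : d.-tuple 'I_n.+1) : (\sum_(i <- t) i <= n)%N -> (g t : 'X_{1..d}) = f t.
  by move=> h; apply: (insubdK (bm0 : mindex d n)); rewrite unfold_in mf ltnS.
pose h (a : mindex d n) : d.-tuple 'I_n.+1 :=
  [tuple inord ((a : 'X_{1..d}) i) | i < d].
have ale (a : mindex d n) i : ((a : 'X_{1..d}) i < n.+1)%N.
  by apply: leq_ltn_trans (bmdeg a); rewrite mdegE (bigD1 i) //= leq_addr.
have fh a : f (h a) = a :> 'X_{1..d}.
  by apply/mnmP => i; rewrite mnmE tnth_mktuple /= inordK.
have hle a : (\sum_(i <- h a) i <= n)%N by rewrite -mf fh -ltnS bmdeg.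
rewrite [RHS](reindex_onto h g) /=; last first.
  move=> t; rewrite inE => ht; apply: eq_from_tnth => i; rewrite tnth_mktuple.
  by rewrite gE // mnmE inord_val.
apply: eq_bigl => a; apply/esym/andP; split; first by rewrite inE; exact: hle.
by apply/eqP/val_inj; rewrite /= gE.
Qed.

Definition mindex_of (d n : nat) (a : 'I_'C(n + d, d)) : mindex d n :=
  enum_val (cast_ord (esym (card_mindex d n)) a).

(* [msize q] is the total degree of q plus one when q is nonzero. *)
Definition on_hypersurface (F : fieldType) (d r k : nat)
    (zeta : 'I_r -> 'I_d -> F) : Prop :=
  exists q : {mpoly F[d]},
    [/\ q != 0, (msize q <= k.+1)%N & forall j : 'I_r, q.@[zeta j] = 0].

End MultiIndex.
Export MultiIndex.

From mathcomp Require Import all_classical all_reals all_analysis.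
Import Order.TTheory GRing.Theory Num.Theory.
Import numFieldNormedType.Exports.

Local Open Scope classical_set_scope.
Local Open Scope ring_scope.

Definition diag_mindex (d n : nat) : {set mindex d n} :=
  [set alpha : mindex d n |
    (mlen alpha == n) && [exists j : 'I_d, mcomp alpha j == n]]%SET.

Section TorusFunctions.
Variables (R : realType) (d : nat).
Implicit Types (f : 'rV[R]_d -> R) (g u : 'rV[R]_d -> R[i]) (x : 'rV[R]_d).

Definition basis_vec (j : 'I_d) : 'rV[R]_d := delta_mx ord0 j.

Definition torus_periodic f : Prop :=
  forall (j : 'I_d) x, f (x + (2 * pi) *: basis_vec j) = f x.

Fixpoint Ck (k : nat) f : Prop :=
  continuous f /\
  if k is k'.+1 then
    forall j : 'I_d, (forall x, derivable f x (basis_vec j)) /\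
      Ck k' (fun x => 'D_(basis_vec j) f x)
  else True.

(* The target R[i] is not a normed module over R, so complex-valued functions
   are differentiated componentwise. *)
Definition pderiv (j : 'I_d) g : 'rV[R]_d -> R[i] := fun x =>
  ('D_(basis_vec j) (fun y => complex.Re (g y)) x +i*
   'D_(basis_vec j) (fun y => complex.Im (g y)) x)%C.

Definition mpderiv (n : nat) (alpha : mindex d n) g : 'rV[R]_d -> R[i] :=
  foldr (fun j h => iter (mcomp alpha j) (pderiv j) h) g (enum 'I_d).

Definition diff_op (n : nat) (p : mindex d n -> 'rV[R]_d -> R) u :
    'rV[R]_d -> R[i] :=
  fun x => \sum_(alpha : mindex d n) (p alpha x)%:C%C * mpderiv alpha u x.

Definition expi (t : R) : R[i] := (cos t +i* sin t)%C.

Definition initial_data (r : nat) (zeta : 'I_r -> 'rV[int]_d) (w : 'I_r -> R) :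
    'rV[R]_d -> R[i] :=
  fun x => \sum_(j < r)
    (w j)%:C%C * expi (\sum_(l < d) (zeta j ord0 l)%:~R * x ord0 l).

(* The row index [k] starts at 0 and stands for k - 1 in S_{k,alpha}; the
   columns follow an arbitrary enumeration of the multi-indices. *)
Definition Smatrix (n : nat) (p : mindex d n -> 'rV[R]_d -> R)
    u0 x : 'M[R[i]]_('C(n + d, d)) :=
  \matrix_(k, a) mpderiv (mindex_of a) (iter k (diff_op p) u0) x.

End TorusFunctions.

Section ProductProbability.
Context {disp : measure_display} {T : measurableType disp} (R : realType).

Definition tuple_cons (n : nat) (z : T * n.-tuple T) : n.+1.-tuple T :=
  [tuple of z.1 :: z.2].

Lemma measurable_tuple_cons (n : nat) :
  measurable_fun [set: T * n.-tuple T] (@tuple_cons n).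
Proof.
by apply: measurable_cons; [exact: measurable_fst|exact: measurable_snd].
Qed.

HB.instance Definition _ (n : nat) :=
  isMeasurableFun.Build _ _ _ _ (@tuple_cons n) (@measurable_tuple_cons n).

Fixpoint product_prob (n : nat) :
    ('I_n -> probability T R) -> probability (n.-tuple T) R :=
  match n with
  | 0 => fun _ => \d_([tuple] : 0.-tuple T)
  | n'.+1 => fun P =>
      distribution (P ord0 \x product_prob (fun i => P (lift ord0 i)))%E
        (@tuple_cons n')
  end.

End ProductProbability.

Section TorusMeasure.
Variable R : realType.

Lemma two_pi_gt0 : 0 < 2 * pi :> R.
Proof. by rewrite mulr_gt0 // pi_gt0. Qed.

(* Normalized Lebesgue measure on T^d, carried by the fundamental domain
   [0, 2 pi]^d. *)
Definition torus_prob (d : nat) : probability (d.-tuple (measurableTypeR R)) R :=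
  product_prob (fun _ : 'I_d => uniform_prob two_pi_gt0).

Definition weights_prob (r : nat) (a b : 'I_r -> R)
    (ab : forall j, a j < b j) : probability (r.-tuple (measurableTypeR R)) R :=
  product_prob (fun j : 'I_r => uniform_prob (ab j)).

Definition torus_point (d : nat) (t : d.-tuple (measurableTypeR R)) : 'rV[R]_d :=
  \row_j tnth t j.

Definition weights (r : nat) (t : r.-tuple (measurableTypeR R)) : 'I_r -> R :=
  fun j => tnth t j.

End TorusMeasure.

(* Main.v *)
Require Import Defs.
From mathcomp Require Import all_boot all_order all_algebra complex.
From mathcomp Require Import all_classical all_reals all_analysis.
From mathcomp Require Import -(notations) mpoly.
From mathcomp Require Import perm zify lra ring.
Import Order.TTheory GRing.Theory Num.Theory.
Import numFieldNormedType.Exports.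
Local Open Scope classical_set_scope.
Local Open Scope ring_scope.

(**
Write e_j(x) for the plane wave with frequency zeta_j. Applying
differential operators to a combination of the e_j multiplies each e_j by a
symbol: there are polynomials Q_{k,alpha}(x) in d variables, with
coefficients depending on x but neither on j nor on the weights, such that
S_{k,alpha}(x) is the sum over j of w_j e_j(x) Q_{k,alpha}(x)(i zeta_j)
([entry_symbolP], [Smatrix_entry]). Thus for fixed x the determinant of S is a
polynomial in the weights, and it is enough to see that it is not the zero
polynomial for almost every x: its real zeros are then a null set for every
product of atomless probabilities ([product_prob_null]), and Fubini's theorem
([product_measure_null]) finishes, the zero set being jointly measurable
because the coefficients of the symbols are continuous in x.

Nonvanishing for fixed x ([exists_det_neq0]). Q_{k,alpha} has degree at most
m n in the frequency. Since no hypersurface of degree at most m n contains all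
the zeta_j, evaluation at the points i zeta_j is injective on polynomials of
degree at most m n, so by duality every linear functional on that space is a
combination of these evaluations ([functional_by_points]); the nonzero factors
e_j(x) are absorbed in complex weights. It remains to find one functional
whose values on the Q_{k,alpha} form an invertible matrix.

At almost every x there is an index j with p_{n e_j}(x) nonzero. Choose
integer weights B_l, the largest of which is B_j, such that the weighted degree
separates the multi-indices of length at most n ([exists_separating_weight]).
The principal part of the operator then has a unique monomial of maximal
weight, with coefficient p_{n e_j}, and hence Q_{k,alpha} (with k counted from
0) has weighted degree exactly k n B_j + weight(alpha), with leading
coefficient p_{n e_j}(x)^k ([symbol_opP], [symbol_SmatrixP]). After the
substitution of T^{B_l} for the l-th variable the symbols become univariate
polynomials of these degrees, and the last row meets the heaviest column in a
degree that occurs in no other entry. Changing a functional on that single power of T changes a single entry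
of the matrix, so an invertible matrix is built by induction on its size
([exists_functional_det_neq0]).
*)

Set Implicit Arguments.
Unset Strict Implicit.
Unset Printing Implicit Defensive.

(** * Functionals separating polynomials of different degrees *)

Definition coef_functional (F : fieldType) (T : nat) (lam : nat -> F)
    (f : {poly F}) : F :=
  \sum_(i < T) lam i * f`_i.

Lemma coef_functional_bump (F : fieldType) (T : nat) (lam : nat -> F) (N : nat)
    (f : {poly F}) :
  (N < T)%N ->
  coef_functional T (fun i => lam i + (i == N)%:R) f
  = coef_functional T lam f + f`_N.
Proof.
move=> NT; rewrite /coef_functional.
under eq_bigr do rewrite mulrDl.
rewrite big_split /=; congr (_ + _).
rewrite (bigD1 (Ordinal NT)) //= eqxx mul1r big1 ?addr0 // => i ne.
rewrite (_ : (i == N :> nat) = false) ?mul0r //.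
by apply: contraNF ne => /eqP h; apply/eqP/val_inj.
Qed.

(** The entry in the last row and in the column [a0] of largest [v] is the only
    one of degree [N], all the others being of smaller degree. Adding 1 to the
    value of the functional on the [N]-th power therefore only changes that entry,
    and changes the determinant by a nonzero multiple of the complementary minor,
    which is nonzero for a suitable functional by induction. One of the two
    functionals has a nonzero determinant. *)
Lemma exists_functional_det_neq0 (F : fieldType) (T m : nat)
    (f : 'I_m -> 'I_m -> {poly F}) (g v : 'I_m -> nat) :
  (forall k k' : 'I_m, (k < k')%N -> (g k < g k')%N) ->
  injective v ->
  (forall k a, size (f k a) = (g k + v a).+1) ->
  (forall k a, (size (f k a) <= T)%N) ->
  exists lam : nat -> F,
    \det (\matrix_(k, a) coef_functional T lam (f k a)) != 0.
Proof.
elim: m f g v => [|m IH] f g v gmono vinj szf fT.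
  by exists (fun=> 0); rewrite det_mx00 oner_neq0.
have [a0 _ a0max] : {a0 : 'I_m.+1 | true & forall a, (v a <= v a0)%N}.
  case: (arg_maxnP (P := predT) v (i0 := ord0)) => // i _ h.
  by exists i => // a; exact: h.
have vlt a : a != a0 -> (v a < v a0)%N.
  move=> ne; rewrite ltn_neqAle a0max andbT; apply: contra_neq ne; exact: vinj.
have gmono' (k k' : 'I_m) : (k < k')%N ->
    (g (lift ord_max k) < g (lift ord_max k'))%N.
  by move=> kk'; apply: gmono; rewrite !lift_max.
have vinj' : injective (fun a => v (lift a0 a)).
  by move=> a b /vinj /lift_inj.
have [lam lamP] := IH (fun k a => f (lift ord_max k) (lift a0 a)) _ _
  gmono' vinj' (fun k a => szf _ _) (fun k a => fT _ _).
pose N := (g ord_max + v a0)%N.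
pose lam' i := lam i + (i == N)%:R.
pose M l : 'M[F]_m.+1 := \matrix_(k, a) coef_functional T l (f k a).
have NT : (N < T)%N by rewrite /N -ltnS -szf ltnS; exact: fT.
have M'E k a : M lam' k a = M lam k a + (f k a)`_N.
  by rewrite !mxE coef_functional_bump.
have fN0 k a : (k != ord_max) || (a != a0) -> (f k a)`_N = 0.
  move=> ne; rewrite nth_default // szf /N.
  have gk : (k != ord_max -> g k < g ord_max)%N.
    by move=> nk; apply: gmono; rewrite ltn_neqAle nk -ltnS ltn_ord.
  have [e|nk] := eqVneq k ord_max; last by move: (gk nk) (a0max a); lia.
  by move: ne; rewrite e eqxx /= => /vlt; lia.
have cof (l : nat -> F) a : cofactor (M l) ord_max a =
    (-1) ^+ (m + a) *
    \det (\matrix_(k, b) coef_functional T l (f (lift ord_max k) (lift a b))).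
  rewrite /cofactor; congr (_ * \det _).
  by apply/matrixP => i j; rewrite !mxE.
have cofE a : cofactor (M lam') ord_max a = cofactor (M lam) ord_max a.
  rewrite !cof; congr (_ * \det _); apply/matrixP => i j; rewrite !mxE.
  by rewrite coef_functional_bump // fN0 ?addr0 // eq_sym neq_lift.
have detE : \det (M lam') =
    \det (M lam) + (f ord_max a0)`_N * cofactor (M lam) ord_max a0.
  rewrite !(expand_det_row _ ord_max) (bigD1 a0) //= [in RHS](bigD1 a0) //=.
  rewrite cofE M'E mulrDl -!addrA; congr (_ + _); rewrite addrC; congr (_ + _).
  apply: eq_bigr => a ne; rewrite cofE M'E fN0 ?addr0 //.
  by rewrite ne orbT.
have lead : (f ord_max a0)`_N * cofactor (M lam) ord_max a0 != 0.
  rewrite mulf_neq0 //; last by rewrite cof mulf_neq0 // signr_eq0.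
  have : lead_coef (f ord_max a0) != 0 by rewrite lead_coef_eq0 -size_poly_eq0 szf.
  by rewrite lead_coefE szf.
have [z|nz] := eqVneq (\det (M lam)) 0; last by exists lam.
by exists lam'; rewrite -/(M lam') detE z add0r.
Qed.

(** * Weights separating multi-indices *)

Definition weight (d : nat) (B : 'I_d -> nat) (b : 'I_d -> nat) : nat :=
  (\sum_(l < d) B l * b l)%N.

(** Uniqueness of base [b] expansions, read off from the lowest digit by
    reduction modulo [b]. *)
Lemma digits_inj (b d : nat) (x y : 'I_d -> nat) :
  (forall l, x l < b)%N -> (forall l, y l < b)%N ->
  (\sum_(l < d) b ^ l * x l = \sum_(l < d) b ^ l * y l)%N -> x =1 y.
Proof.
elim: d x y => [|d IH] x y xb yb; first by move=> _ [].
have b0 : (0 < b)%N by move: (xb ord0); lia.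
rewrite !big_ord_recl /= !expn0 !mul1n.
have E (z : 'I_d.+1 -> nat) : (\sum_(i < d) b ^ bump 0 i * z (lift ord0 i)
    = b * \sum_(i < d) b ^ i * z (lift ord0 i))%N.
  by rewrite big_distrr; apply: eq_bigr => i _; rewrite /= /bump add1n expnS mulnA.
rewrite !E => e.
have e0 : x ord0 = y ord0.
  move/(congr1 (modn^~ b)): e.
  by rewrite ![(b * _)%N]mulnC !(addnC _ (_ * b)%N) !modnMDl !modn_small.
move/eqP: e; rewrite e0 eqn_add2l eqn_pmul2l // => /eqP e i.
case: (unliftP ord0 i) => [j|] -> //.
exact: (IH (fun j => x (lift ord0 j)) (fun j => y (lift ord0 j))).
Qed.

(** Distinct powers of [n.+1] serve as weights, the largest being given to [j],
    so that the weight of a multi-index reads as an expansion in base [n.+1]. *)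
Lemma exists_separating_weight (d n : nat) (j : 'I_d) :
  exists B : 'I_d -> nat,
    [/\ forall l, (0 < B l <= B j)%N &
     forall x y : 'I_d -> nat, (forall l, x l <= n)%N -> (forall l, y l <= n)%N ->
       weight B x = weight B y -> x =1 y].
Proof.
case: d j => [[]//|d] j; pose s := tperm j ord_max.
exists (fun l => n.+1 ^ s l)%N; split=> [l|x y xn yn].
  by rewrite expn_gt0 /= /s tpermL leq_pexp2l //= -ltnS ltn_ord.
have E z : weight (fun l => n.+1 ^ s l)%N z = (\sum_(l < d.+1) n.+1 ^ l * z (s l))%N.
  rewrite /weight (reindex_inj (perm_inj (s := s))) /=.
  by apply: eq_bigr => i _; rewrite tpermK.
rewrite !E => /(digits_inj (b := n.+1) (x := x \o s) (y := y \o s)) h l.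
by have := h (fun _ => xn _) (fun _ => yn _) (s l); rewrite /= tpermK.
Qed.

(** * Functionals as combinations of point evaluations *)

Lemma mpoly_sum_bounded (F : fieldType) (d K : nat) (P : mpoly d F) :
  (msize P <= K.+1)%N ->
  P = \sum_(b : mindex d K) mcoeff b P *: mpolyX F b.
Proof. by move=> h; rewrite {1}(mpolywE h). Qed.

Lemma meval_sum_bounded (F : fieldType) (d K : nat) (P : mpoly d F) (v : 'I_d -> F) :
  (msize P <= K.+1)%N ->
  meval v P = \sum_(b : mindex d K) mcoeff b P * \prod_(l < d) v l ^+ mcomp b l.
Proof.
move=> h; rewrite {1}(mpoly_sum_bounded h) raddf_sum /=.
by apply: eq_bigr => b _; rewrite mevalZ mevalX.
Qed.

Lemma msize_le_mdeg (F : fieldType) (d K : nat) (P : mpoly d F) :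
  (forall b : multinom d, (K < mdeg b)%N -> mcoeff b P = 0) -> (msize P <= K.+1)%N.
Proof.
move=> h; rewrite msizeE; apply/bigmax_leqP_seq => b bP _; rewrite ltnS leqNgt.
by apply: contraL bP => /h e; rewrite mcoeff_msupp e eqxx.
Qed.

(** The matrix of the monomials of degree at most [K] at the points has
    independent rows, because a relation between the rows is a polynomial of degree
    at most [K] vanishing at all the points. It hence has a right inverse, also
    over the larger field [L], and this solves for the coefficients [c]. The
    scalar [u] scales each monomial by a nonzero factor; it stands for the
    imaginary unit. *)
Lemma functional_by_points (F L : fieldType) (iota : {rmorphism F -> L}) (u : L)
    (d r K : nat) (zeta : 'I_r -> 'I_d -> F) (y : mindex d K -> L) :
  u != 0 -> ~ on_hypersurface K zeta ->
  exists c : 'I_r -> L, forall P : mpoly d L, (msize P <= K.+1)%N ->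
    \sum_(j < r) c j * meval (fun l => u * iota (zeta j l)) P
    = \sum_(b : mindex d K) mcoeff b P * y b.
Proof.
move=> u0 nh.
pose V : 'M[F]_(#|mindex d K|, r) :=
  \matrix_(b, j) \prod_(l < d) zeta j l ^+ mcomp (enum_val b) l.
have Vfree : row_free V.
  apply: inj_row_free => q qV.
  pose P : mpoly d F := \sum_(b : mindex d K) q ord0 (enum_rank b) *: mpolyX F b.
  have Pc (b : mindex d K) : mcoeff b P = q ord0 (enum_rank b).
    pose E (m : multinom d) : F :=
      if insub m is Some b' then q ord0 (enum_rank (b' : mindex d K)) else 0.
    have -> : P = \sum_(b : mindex d K) E b *: mpolyX F b.
      by apply: eq_bigr => c _; rewrite /E valK.
    by rewrite mcoeff_mpoly ?bmdeg // /E valK.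
  apply/rowP => i; rewrite mxE -(enum_valK i) -Pc.
  have [->|P0] := eqVneq P 0; first by rewrite mcoeff0.
  case: nh; exists P.
  have sP : (msize P <= K.+1)%N.
    apply: msize_le_mdeg => b bK; rewrite raddf_sum big1 //= => c _.
    rewrite mcoeffZ mcoeffX; case: eqP => [e|]; last by rewrite mulr0.
    by move: bK; rewrite -e ltnNge -ltnS bmdeg.
  split=> // j; rewrite (meval_sum_bounded _ sP).
  transitivity ((q *m V) ord0 j); last by rewrite qV mxE.
  rewrite mxE (reindex (@enum_val (mindex d K) predT)) /=; last first.
    exact: (onW_bij _ (enum_val_bij _)).
  by apply: eq_bigr => b _; rewrite Pc enum_valK mxE.
have /row_freeP[W VW] : row_free (map_mx iota V) by rewrite row_free_map.
(* The entry for the monomial b is divided by the factor that b picks up when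
   the points are scaled by u. *)
pose z : 'cV[L]_(#|mindex d K|) := \col_b (y (enum_val b) / u ^+ mlen (enum_val b)).
exists (fun j => (W *m z) j ord0) => P sP.
under eq_bigr do rewrite (meval_sum_bounded _ sP) mulr_sumr.
rewrite exchange_big /=; apply: eq_bigr => b _.
under eq_bigr do rewrite mulrCA.
rewrite -mulr_sumr; congr (_ * _).
have e : (map_mx iota V *m (W *m z)) (enum_rank b) ord0 = z (enum_rank b) ord0.
  by rewrite mulmxA VW mul1mx.
rewrite [in RHS]mxE enum_rankK in e.
rewrite -[RHS](mulfVK (expf_neq0 (mlen b) u0)) -e [in RHS]mxE mulr_suml.
apply: eq_bigr => j _; rewrite !mxE enum_rankK rmorph_prod /=.
rewrite -mulrA [RHS]mulrC -mulrA; congr (_ * _).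
rewrite /mlen mdegE -prodrXr -big_split /=; apply: eq_bigr => l _.
by rewrite exprMn rmorphXn.
Qed.

(** * The substitution of powers of one variable *)

(** Kronecker's substitution of the [B l]-th power of a single variable for the
    [l]-th variable, under which the weighted degree becomes the degree. *)
Definition power_subst (F : fieldType) (d : nat) (B : 'I_d -> nat)
    (P : mpoly d F) : {poly F} :=
  mmap (@polyC F) (fun l => 'X^(B l)) P.

Lemma power_substD (F : fieldType) (d : nat) (B : 'I_d -> nat) :
  {morph @power_subst F d B : P Q / P + Q}.
Proof. exact: mmapD. Qed.

Lemma power_substZ (F : fieldType) (d : nat) (B : 'I_d -> nat) (c : F) (P : mpoly d F) :
  power_subst B (c *: P) = c *: power_subst B P.
Proof. by rewrite /power_subst mmapZ mul_polyC. Qed.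

Lemma power_subst_mulX (F : fieldType) (d : nat) (B : 'I_d -> nat) (l : 'I_d)
    (P : mpoly d F) :
  power_subst B (mpolyX F (mnm1 l) * P) = 'X^(B l) * power_subst B P.
Proof. by rewrite /power_subst rmorphM /= mmapX mmap1U. Qed.

Lemma power_substX (F : fieldType) (d : nat) (B : 'I_d -> nat) (m : multinom d) :
  power_subst B (mpolyX F m) = 'X^(weight B m).
Proof.
rewrite /power_subst mmapX /mmap1 /weight -prodrXr; apply: eq_bigr => l _.
by rewrite exprM.
Qed.

Lemma power_substE (F : fieldType) (d : nat) (B : 'I_d -> nat) (P : mpoly d F) :
  power_subst B P = \sum_(m <- msupp P) mcoeff m P *: 'X^(weight B m).
Proof.
rewrite {1}(mpolyE P) /power_subst raddf_sum /=; apply: eq_bigr => m _.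
by rewrite -/(power_subst _ _) power_substZ power_substX.
Qed.

Lemma size_power_subst_le (F : fieldType) (d N : nat) (B : 'I_d -> nat) (P : mpoly d F) :
  (forall m : multinom d, (N < weight B m)%N -> mcoeff m P = 0) ->
  (size (power_subst B P) <= N.+1)%N.
Proof.
move=> h; rewrite power_substE; elim/big_rec: _ => [|m Q _ IH]; first by rewrite size_poly0.
apply: (leq_trans (size_polyD _ _)); rewrite geq_max IH andbT.
have [w|w] := leqP (weight B m) N; last by rewrite h // scale0r size_poly0.
by apply: (leq_trans (size_scale_leq _ _)); rewrite size_polyXn.
Qed.

Lemma coef_functional_power_subst (F : fieldType) (d K T : nat)
    (lam : nat -> F) (B : 'I_d -> nat)
    (P : mpoly d F) : (msize P <= K.+1)%N ->
  coef_functional T lam (power_subst B P) =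
  \sum_(b : mindex d K) mcoeff b P * coef_functional T lam 'X^(weight B (mcomp b)).
Proof.
move=> sP.
have -> : power_subst B P = \sum_(b : mindex d K) mcoeff b P *: 'X^(weight B (mcomp b)).
  rewrite {1}(mpoly_sum_bounded sP) /power_subst raddf_sum /=; apply: eq_bigr => b _.
  by rewrite -/(power_subst _ _) power_substZ power_substX.
rewrite /coef_functional.
under eq_bigr do rewrite coef_sum mulr_sumr.
rewrite exchange_big /=; apply: eq_bigr => b _.
by rewrite mulr_sumr; apply: eq_bigr => i _; rewrite coefZ mulrCA.
Qed.

(** * Partial derivatives of complex-valued functions *)

(** A directional derivative is the ordinary derivative along a line, which
    gives access to the one-variable chain rule. *)
Lemma is_derive_line (R : realType) (V : normedModType R) (f : V -> R) (x v : V) (df : R) :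
  is_derive (0 : R) 1 (fun h : R => f (h *: v + x)) df -> is_derive x v f df.
Proof.
move=> [d1 d2]; split; first exact: (proj2 (derivable1P f x v) d1).
rewrite -d2 /derive; set g1 := fun h => h^-1 *: _; set g2 := fun h => h^-1 *: _.
suff -> : g1 = g2 by [].
by rewrite funeqE /g1 /g2 => h /=; rewrite addr0 scale0r add0r [_%:A]mulr1.
Qed.

Section ComplexCalculus.
Variables (R : realType) (d : nat).
Implicit Types (f : 'rV[R]_d -> R) (g : 'rV[R]_d -> R[i]) (x : 'rV[R]_d).

Lemma Ck_cst k (c : R) : Ck k (fun _ : 'rV[R]_d => c).
Proof.
elim: k c => [|k IH] c /=; split=> //; try exact: cst_continuous.
move=> j; split=> [x|]; first exact: derivable_cst.
rewrite [X in Ck _ X](_ : _ = fun=> 0); first exact: IH.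
by apply/funext => x; exact: derive_cst.
Qed.

Lemma Ck_pred k f : Ck k.+1 f -> Ck k f.
Proof.
elim: k f => [|k IH] f [fc fd]; split=> //.
by move=> j; have [dj cj] := fd j; split => //; exact: IH.
Qed.

Lemma Ck_leq k k' f : (k <= k')%N -> Ck k' f -> Ck k f.
Proof.
move=> /subnK <-; elim: (k' - k)%N => // s IH; rewrite addSn => /Ck_pred.
exact: IH.
Qed.

Lemma CkD k f1 f2 : Ck k f1 -> Ck k f2 -> Ck k (fun x => f1 x + f2 x).
Proof.
elim: k f1 f2 => [|k IH] f1 f2 [c1 d1] [c2 d2]; split => //.
- by move=> x; exact: (cvgD (c1 x) (c2 x)).
- by move=> x; exact: (cvgD (c1 x) (c2 x)).
move=> j; have [h1 e1] := d1 j; have [h2 e2] := d2 j; split.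
  by move=> x; exact: derivableD.
rewrite [X in Ck _ X](_ : _ =
  fun x => 'D_(basis_vec R j) f1 x + 'D_(basis_vec R j) f2 x); first exact: IH.
by apply/funext => x; exact: deriveD.
Qed.

Lemma CkM k f1 f2 : Ck k f1 -> Ck k f2 -> Ck k (fun x => f1 x * f2 x).
Proof.
elim: k f1 f2 => [|k IH] f1 f2 C1 C2; have [c1 d1] := C1; have [c2 d2] := C2.
  by split => // x; exact: (cvgM (c1 x) (c2 x)).
split; first by move=> x; exact: (cvgM (c1 x) (c2 x)).
move=> j; have [h1 e1] := d1 j; have [h2 e2] := d2 j; split.
  by move=> x; exact: derivableM.
rewrite [X in Ck _ X](_ : _ =
  fun x => f1 x * 'D_(basis_vec R j) f2 x + f2 x * 'D_(basis_vec R j) f1 x).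
  by apply: CkD; apply: IH => //; exact: Ck_pred.
by apply/funext => x; exact: deriveM.
Qed.

Definition CkC k g := Ck k (fun x => complex.Re (g x)) /\ Ck k (fun x => complex.Im (g x)).

Lemma CkC_cst k (c : R[i]) : CkC k (fun=> c).
Proof. by split; exact: Ck_cst. Qed.

Lemma CkC_leq k k' g : (k <= k')%N -> CkC k' g -> CkC k g.
Proof. by move=> kk' [? ?]; split; exact: (Ck_leq kk'). Qed.

Lemma CkC_real k f : Ck k f -> CkC k (fun x => (f x)%:C%C).
Proof. by move=> fk; split => //; exact: Ck_cst. Qed.

Lemma CkCD k g1 g2 : CkC k g1 -> CkC k g2 -> CkC k (fun x => g1 x + g2 x).
Proof.
move=> [a1 b1] [a2 b2]; split.
- rewrite [X in Ck _ X](_ : _ = fun x => complex.Re (g1 x) + complex.Re (g2 x)).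
    exact: CkD.
  by apply/funext => x; case: (g1 x); case: (g2 x).
- rewrite [X in Ck _ X](_ : _ = fun x => complex.Im (g1 x) + complex.Im (g2 x)).
    exact: CkD.
  by apply/funext => x; case: (g1 x); case: (g2 x).
Qed.

Lemma CkCM k g1 g2 : CkC k g1 -> CkC k g2 -> CkC k (fun x => g1 x * g2 x).
Proof.
have CkN f : Ck k f -> Ck k (fun x => - 1 * f x) by exact/CkM/Ck_cst.
move=> [a1 b1] [a2 b2]; split.
- rewrite [X in Ck _ X](_ : _ = fun x => complex.Re (g1 x) * complex.Re (g2 x)
                     + -1 * (complex.Im (g1 x) * complex.Im (g2 x))).
    by apply: CkD; [exact: CkM|apply: CkN; exact: CkM].
  by apply/funext => x; rewrite mulN1r; case: (g1 x); case: (g2 x).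
- rewrite [X in Ck _ X](_ : _ = fun x => complex.Re (g1 x) * complex.Im (g2 x)
                     + complex.Im (g1 x) * complex.Re (g2 x)).
    by apply: CkD; exact: CkM.
  by apply/funext => x; case: (g1 x); case: (g2 x).
Qed.

Lemma CkC_sum (I : Type) (s : seq I) k (G : I -> 'rV[R]_d -> R[i]) :
  (forall i, CkC k (G i)) -> CkC k (fun x => \sum_(i <- s) G i x).
Proof.
move=> h; elim: s => [|i s IH].
  under [X in CkC _ X]eq_fun do rewrite big_nil.
  exact: CkC_cst.
under [X in CkC _ X]eq_fun do rewrite big_cons.
exact: CkCD.
Qed.

Definition is_pderiv (j : 'I_d) x g (dg : R[i]) : Prop :=
  is_derive x (basis_vec R j) (fun y => complex.Re (g y)) (complex.Re dg) /\
  is_derive x (basis_vec R j) (fun y => complex.Im (g y)) (complex.Im dg).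

Lemma is_pderivE j x g dg : is_pderiv j x g dg -> pderiv j g x = dg.
Proof. by move=> [[_ e1] [_ e2]]; rewrite /pderiv e1 e2; case: dg {e1 e2}. Qed.

Lemma CkC_is_pderiv j x k g : CkC k.+1 g -> is_pderiv j x g (pderiv j g x).
Proof.
move=> [[_ a] [_ b]]; split; split=> //.
- by have [] := a j.
- by have [] := b j.
Qed.

Lemma CkC_pderiv j k g : CkC k.+1 g -> CkC k (pderiv j g).
Proof.
move=> [[_ a] [_ b]]; split.
- by have [] := a j.
- by have [] := b j.
Qed.

Lemma is_pderiv_cst j x (c : R[i]) : is_pderiv j x (fun=> c) 0.
Proof. by split; exact: is_derive_cst. Qed.

Lemma is_pderivD j x g1 g2 dg1 dg2 :
  is_pderiv j x g1 dg1 -> is_pderiv j x g2 dg2 ->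
  is_pderiv j x (fun y => g1 y + g2 y) (dg1 + dg2).
Proof.
move=> [a1 b1] [a2 b2]; split.
- rewrite [X in is_derive _ _ X _](_ : _ =
    (fun y => complex.Re (g1 y)) + (fun y => complex.Re (g2 y))).
    rewrite (_ : complex.Re _ = complex.Re dg1 + complex.Re dg2); first exact: is_deriveD.
    by case: dg1 {a1 b1}; case: dg2 {a2 b2}.
  by apply/funext => y; rewrite fctE; case: (g1 y); case: (g2 y).
- rewrite [X in is_derive _ _ X _](_ : _ =
    (fun y => complex.Im (g1 y)) + (fun y => complex.Im (g2 y))).
    rewrite (_ : complex.Im _ = complex.Im dg1 + complex.Im dg2); first exact: is_deriveD.
    by case: dg1 {a1 b1}; case: dg2 {a2 b2}.
  by apply/funext => y; rewrite fctE; case: (g1 y); case: (g2 y).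
Qed.

Lemma is_pderivM j x g1 g2 dg1 dg2 :
  is_pderiv j x g1 dg1 -> is_pderiv j x g2 dg2 ->
  is_pderiv j x (fun y => g1 y * g2 y) (dg1 * g2 x + g1 x * dg2).
Proof.
move=> [a1 b1] [a2 b2]; split.
- rewrite [X in is_derive _ _ X _](_ : _ =
    (fun y => complex.Re (g1 y)) * (fun y => complex.Re (g2 y))
     - (fun y => complex.Im (g1 y)) * (fun y => complex.Im (g2 y))).
    apply: (is_derive_eq (is_deriveB (is_deriveM a1 a2) (is_deriveM b1 b2))).
    case: (g1 x) (g2 x) dg1 dg2 {a1 b1 a2 b2} => [? ?] [? ?] [? ?] [? ?] /=.
    by rewrite /GRing.scale /=; ring.
  by apply/funext => y; rewrite !fctE; case: (g1 y); case: (g2 y).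
- rewrite [X in is_derive _ _ X _](_ : _ =
    (fun y => complex.Re (g1 y)) * (fun y => complex.Im (g2 y))
     + (fun y => complex.Im (g1 y)) * (fun y => complex.Re (g2 y))).
    apply: (is_derive_eq (is_deriveD (is_deriveM a1 b2) (is_deriveM b1 a2))).
    case: (g1 x) (g2 x) dg1 dg2 {a1 b1 a2 b2} => [? ?] [? ?] [? ?] [? ?] /=.
    by rewrite /GRing.scale /=; ring.
  by apply/funext => y; rewrite !fctE; case: (g1 y); case: (g2 y).
Qed.

Lemma is_pderiv_sum (I : Type) (s : seq I) j x (G : I -> 'rV[R]_d -> R[i]) (dG : I -> R[i]) :
  (forall i, is_pderiv j x (G i) (dG i)) ->
  is_pderiv j x (fun y => \sum_(i <- s) G i y) (\sum_(i <- s) dG i).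
Proof.
move=> h; elim: s => [|i s IH].
  under [X in is_pderiv _ _ X _]eq_fun do rewrite big_nil.
  by rewrite big_nil; exact: is_pderiv_cst.
under [X in is_pderiv _ _ X _]eq_fun do rewrite big_cons.
by rewrite big_cons; exact: is_pderivD.
Qed.

Definition phase (v : 'I_d -> R) x : R := \sum_(l < d) v l * x ord0 l.

Lemma phase_line (v : 'I_d -> R) (l : 'I_d) x (h : R) :
  phase v (h *: basis_vec R l + x) = h * v l + phase v x.
Proof.
rewrite /phase; under eq_bigr do rewrite !mxE mulrDr.
rewrite big_split /=; congr (_ + _).
rewrite (bigD1 l) //= !eqxx mulr1 mulrC big1 ?addr0 // => i ne.
by rewrite (negbTE ne) /= !mulr0.
Qed.

(** Differentiating a plane wave multiplies it by [i] times a component of its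
    frequency: this is what turns derivatives into symbols. *)
Lemma is_pderiv_expi (v : 'I_d -> R) (l : 'I_d) x :
  is_pderiv l x (fun y => expi (phase v y)) ('i%C * (v l)%:C%C * expi (phase v x)).
Proof.
have lin : is_derive (0 : R) 1 (fun h : R => h * v l + phase v x) (v l).
  apply: is_derive_eq.
  by rewrite /GRing.scale /=; ring.
split; apply: is_derive_line => /=.
- under [X in is_derive _ _ X _]eq_fun do rewrite phase_line.
  apply: (is_derive_eq (is_derive1_comp (is_derive_cos _) lin)).
  by rewrite mul0r add0r; ring.
- under [X in is_derive _ _ X _]eq_fun do rewrite phase_line.
  apply: (is_derive_eq (is_derive1_comp (is_derive_sin _) lin)).
  by rewrite mul0r add0r; ring.
Qed.

End ComplexCalculus.

(** * Symbols of differential operators *)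

Section Symbols.
Variables (R : realType) (d K : nat).
Implicit Types (q : 'rV[R]_d -> mpoly d R[i]) (x : 'rV[R]_d).

Lemma mcoeff_mulX (l : 'I_d) (b : multinom d) (P : mpoly d R[i]) :
  mcoeff b (mpolyX R[i] (mnm1 l) * P) =
  if (0 < b l)%N then mcoeff (mnm_sub b (mnm1 l)) P else 0.
Proof.
rewrite mulrC; case: ifPn => bl.
  have {1}-> : b = mnm_add (mnm1 l) (mnm_sub b (mnm1 l)); last exact: mcoeffMX.
  by rewrite addmC submK // lep1mP -lt0n.
apply: memN_msupp_eq0; rewrite (perm_mem (msuppMX _ _)).
apply: contra bl => /mapP [c _ ->].
by rewrite mnmDE mnm1E eqxx.
Qed.

(** The derivative acting on the coefficients of a polynomial that depends on
    [x]; it only keeps monomials of degree at most [K], which gives a finite sum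
    and changes nothing as long as the degree of [q] is at most [K]. *)
Definition coef_pderiv (l : 'I_d) q x : mpoly d R[i] :=
  \sum_(b : mindex d K) pderiv l (fun y => mcoeff b (q y)) x *: mpolyX R[i] b.

(** By the Leibniz rule, differentiating [q(x)(i v)] times the plane wave of
    frequency [v] either multiplies by [i v l] or differentiates the coefficients
    of [q]. *)
Definition symbol_pderiv (l : 'I_d) q x : mpoly d R[i] :=
  mpolyX R[i] (mnm1 l) * q x + coef_pderiv l q x.

Lemma mcoeff_coef_pderiv l q x (b : multinom d) :
  mcoeff b (coef_pderiv l q x) =
  if (mdeg b <= K)%N then pderiv l (fun y => mcoeff b (q y)) x else 0.
Proof.
case: ifPn => bK.
  pose E (m : multinom d) : R[i] := pderiv l (fun y => mcoeff m (q y)) x.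
  by rewrite /coef_pderiv (mcoeff_mpoly E).
rewrite /coef_pderiv raddf_sum big1 //= => c _; rewrite mcoeffZ mcoeffX.
case: eqP => [e|]; last by rewrite mulr0.
by case/negP: bK; rewrite -e -ltnS; exact: bmdeg.
Qed.

Definition coefs_Ck (s : nat) q : Prop := forall b, CkC s (fun x => mcoeff b (q x)).

Definition weight_le (B : 'I_d -> nat) (N : nat) q : Prop :=
  forall x (b : multinom d), (N < weight B b)%N -> mcoeff b (q x) = 0.

(** The [N]-th coefficient after the substitution is the sum of the coefficients
    of all monomials of weight [N]. *)
Definition top_coef (B : 'I_d -> nat) (N : nat) (c : 'rV[R]_d -> R[i]) q : Prop :=
  forall x, (power_subst B (q x))`_N = c x.

Lemma coefs_Ck_symbol_pderiv s l q : coefs_Ck s.+1 q -> coefs_Ck s (symbol_pderiv l q).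
Proof.
move=> h b; under [X in CkC _ X]eq_fun do rewrite mcoeffD mcoeff_mulX mcoeff_coef_pderiv.
apply: CkCD.
  case: (0 < b l)%N; last exact: CkC_cst.
  exact: CkC_leq (leqnSn s) (h _).
case: (mdeg b <= K)%N; last exact: CkC_cst.
by apply: CkC_pderiv; exact: h.
Qed.

Lemma pderiv0 (l : 'I_d) x : pderiv l (fun _ : 'rV[R]_d => 0) x = 0.
Proof. exact: is_pderivE (is_pderiv_cst _ _ _). Qed.

Lemma weight_le_coef_pderiv B N l q : weight_le B N q -> weight_le B N (coef_pderiv l q).
Proof.
move=> h x b bN; rewrite mcoeff_coef_pderiv; case: ifP => // _.
by under [X in pderiv _ X _]eq_fun do rewrite h //; exact: pderiv0.
Qed.

Lemma weight_sub (B : 'I_d -> nat) (l : 'I_d) (b : multinom d) : (0 < b l)%N ->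
  weight B b = (B l + weight B (mnm_sub b (mnm1 l)))%N.
Proof.
move=> bl; rewrite /weight (bigD1 l) //= [in RHS](bigD1 l) //= addnA.
congr (_ + _)%N.
  by rewrite mnmBE mnm1E eqxx /= -mulnS; congr (_ * _)%N; lia.
apply: eq_bigr => i ne; rewrite mnmBE mnm1E eq_sym (negbTE ne) /=.
by rewrite subn0.
Qed.

Lemma weight_le_symbol_pderiv B N l q :
  weight_le B N q -> weight_le B (N + B l) (symbol_pderiv l q).
Proof.
move=> h x b bN; rewrite mcoeffD mcoeff_mulX (weight_le_coef_pderiv _ h) ?addr0; last by lia.
by case: ifP => // bl; apply: h; move: bN; rewrite (weight_sub B bl); lia.
Qed.

Lemma power_subst_coef_gt (B : 'I_d -> nat) N M q x :
  weight_le B N q -> (N < M)%N -> (power_subst B (q x))`_M = 0.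
Proof. by move=> h NM; rewrite nth_default // (leq_trans (size_power_subst_le (h x))). Qed.

(** The multiplication by a variable raises the weight, whereas the derivative
    of the coefficients does not, so the top coefficient is not differentiated. *)
Lemma top_coef_symbol_pderiv B N c l q : (0 < B l)%N ->
  weight_le B N q -> top_coef B N c q -> top_coef B (N + B l) c (symbol_pderiv l q).
Proof.
move=> Bl wq tq x; rewrite power_substD power_subst_mulX coefD coefXnM addnK.
rewrite ltnNge leq_addl /= tq (power_subst_coef_gt x (weight_le_coef_pderiv l wq)) ?addr0 //.
by rewrite -addn1 leq_add2l.
Qed.

(** [s] counts the derivatives still available on the coefficients, [D] bounds
    the total degree, and [c] is the coefficient in the top weight [N]. Taking a
    derivative consumes one unit of [s] and raises [D] by one. *)
Definition symbol B s D N c q : Prop :=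
  [/\ coefs_Ck s q, weight_le (fun=> 1%N) D q, weight_le B N q & top_coef B N c q].

Variables (r : nat) (v : 'I_r -> 'I_d -> R).

(** The function with symbol [q]: the superposition with weights [w] of the plane
    waves of frequencies [v], each multiplied by the value of [q] at [i v]. *)
Definition realize (w : 'I_r -> R[i]) q x : R[i] :=
  \sum_(j < r) w j * (meval (fun l => 'i%C * (v j l)%:C%C) (q x) * expi (phase (v j) x)).

Lemma weight1 (b : multinom d) : weight (fun=> 1%N) b = mdeg b.
Proof. by rewrite /weight mdegE; apply: eq_bigr => l _; rewrite mul1n. Qed.

Lemma msize_weight_le D q x :
  weight_le (fun=> 1%N) D q -> (D <= K)%N -> (msize (q x) <= K.+1)%N.
Proof.
move=> h DK; apply: msize_le_mdeg => b bK; apply: h; rewrite weight1.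
exact: leq_ltn_trans bK.
Qed.

Lemma pderiv_realize l w D q : coefs_Ck 1 q -> weight_le (fun=> 1%N) D q -> (D <= K)%N ->
  pderiv l (realize w q) = realize w (symbol_pderiv l q).
Proof.
move=> Cq Dq DK; apply/funext => x; apply: is_pderivE.
apply: is_pderiv_sum => j.
set u := fun k : 'I_d => 'i%C * (v j k)%:C%C.
rewrite [X in is_pderiv _ _ _ X](_ : _ = 0 * (meval u (q x) * expi (phase (v j) x)) +
   w j * ((\sum_(b : mindex d K) (pderiv l (fun y => mcoeff b (q y)) x *
              (\prod_(k < d) u k ^+ mcomp b k) +
               mcoeff b (q x) * 0)) * expi (phase (v j) x)
    + meval u (q x) * (u l * expi (phase (v j) x)))).
  apply: is_pderivM; first exact: is_pderiv_cst.
  apply: is_pderivM; last exact: is_pderiv_expi.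
  under [X in is_pderiv _ _ X _]eq_fun do
    rewrite (meval_sum_bounded _ (msize_weight_le _ Dq DK)).
  apply: is_pderiv_sum => b; apply: is_pderivM; last exact: is_pderiv_cst.
  exact: CkC_is_pderiv (Cq b).
rewrite mul0r add0r; congr (_ * _).
rewrite mevalD mevalM mevalXU [RHS]addrC mulrDl; congr (_ + _).
  by rewrite mulrCA mulrA.
congr (_ * _); rewrite /coef_pderiv raddf_sum /=; apply: eq_bigr => b _.
by rewrite mulr0 addr0 mevalZ mevalX.
Qed.

Lemma symbol_pderivP B s D N c l q : (0 < B l)%N ->
  symbol B s.+1 D N c q -> symbol B s D.+1 (N + B l) c (symbol_pderiv l q).
Proof.
move=> Bl [Cq Dq Nq cq]; split.
- exact: coefs_Ck_symbol_pderiv.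
- by rewrite -(addn1 D); exact: weight_le_symbol_pderiv Dq.
- exact: weight_le_symbol_pderiv.
- exact: top_coef_symbol_pderiv.
Qed.

Definition symbol_mpderiv (n : nat) (alpha : mindex d n) q :=
  foldr (fun j h => iter (mcomp alpha j) (symbol_pderiv j) h) q (enum 'I_d).

Lemma symbol_iter B w (l : 'I_d) k s D N c q : (0 < B l)%N -> (D + k <= K)%N ->
  symbol B (s + k) D N c q ->
  symbol B s (D + k) (N + B l * k) c (iter k (symbol_pderiv l) q) /\
  iter k (pderiv l) (realize w q) = realize w (iter k (symbol_pderiv l) q).
Proof.
move=> Bl; elim: k s => [|k IH] s Dk; first by rewrite !addn0 muln0 addn0.
rewrite addnS -addSn => /IH [|Sq e]; first by lia.
rewrite !iterS e mulnSr addnA addnS; split; first exact: symbol_pderivP.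
have [Cq Dq _ _] := Sq; apply: (@pderiv_realize l w (D + k)%N) => //; last by lia.
by move=> b; apply: CkC_leq (Cq b).
Qed.

Lemma symbol_mpderivP B w n (alpha : mindex d n) s D N c q :
  (forall l, 0 < B l)%N -> (D + mlen alpha <= K)%N ->
  symbol B (s + mlen alpha) D N c q ->
  symbol B s (D + mlen alpha) (N + weight B (mcomp alpha)) c (symbol_mpderiv alpha q) /\
  mpderiv alpha (realize w q) = realize w (symbol_mpderiv alpha q).
Proof.
move=> B0.
have -> : mlen alpha = (\sum_(l <- enum 'I_d) mcomp alpha l)%N.
  by rewrite /mlen mdegE big_enum.
have -> : weight B (mcomp alpha) = (\sum_(l <- enum 'I_d) B l * mcomp alpha l)%N.
  by rewrite /weight big_enum.
rewrite /symbol_mpderiv /mpderiv; elim: (enum 'I_d) s => [|l ls IH] s /=.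
  by rewrite !big_nil !addn0.
rewrite !big_cons !addnA => DK Sq.
have [|S1 e1] := IH (s + mcomp alpha l)%N _ Sq.
  by apply: leq_trans DK; rewrite leq_add2r leq_addr.
rewrite e1 [(D + _ + _)%N]addnAC [(N + _ + _)%N]addnAC.
by apply: symbol_iter => //; rewrite addnAC.
Qed.

Definition symbol_op (n : nat) (p : mindex d n -> 'rV[R]_d -> R) q x : mpoly d R[i] :=
  \sum_(alpha : mindex d n) (p alpha x)%:C%C *: symbol_mpderiv alpha q x.

End Symbols.

Section SymbolOp.
Variables (R : realType) (d K n : nat) (p : mindex d n -> 'rV[R]_d -> R).
Variables (r : nat) (v : 'I_r -> 'I_d -> R).
Variables (B : 'I_d -> nat) (M : nat) (alpha0 : mindex d n).
Hypothesis B_gt0 : forall l, (0 < B l)%N.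
Hypothesis weight_alpha0 : weight B (mcomp alpha0) = M.
Hypothesis weight_lt : forall alpha : mindex d n,
  alpha != alpha0 -> (weight B (mcomp alpha) < M)%N.
Implicit Types (q : 'rV[R]_d -> mpoly d R[i]) (x : 'rV[R]_d).

Lemma power_subst_sum (I : finType) (P : I -> mpoly d R[i]) :
  power_subst B (\sum_i P i) = \sum_i power_subst B (P i).
Proof. by apply: (big_morph (power_subst B) (@power_substD _ _ _)); rewrite /power_subst mmap0. Qed.

Lemma symbol_leq s s' D N c q : (s <= s')%N -> symbol B s' D N c q -> symbol B s D N c q.
Proof. by move=> ss [h *]; split => // b; exact: CkC_leq ss (h b). Qed.

Lemma mlen_le (alpha : mindex d n) : (mlen alpha <= n)%N.
Proof. by rewrite -ltnS; exact: bmdeg. Qed.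

(** Among the multi-indices of the operator [alpha0] alone has maximal weight, so
    only its coefficient enters the top coefficient of the new symbol. *)
Lemma symbol_opP w s D N c q :
  (forall alpha, Ck s (p alpha)) -> (D + n <= K)%N -> symbol B (s + n) D N c q ->
  symbol B s (D + n) (N + M) (fun x => (p alpha0 x)%:C%C * c x) (symbol_op K p q) /\
  diff_op p (realize v w q) = realize v w (symbol_op K p q).
Proof.
move=> Cp DK Sq.
have H (alpha : mindex d n) :=
  symbol_mpderivP (K := K) v w (alpha := alpha) (s := s) B_gt0
  (leq_trans (leq_add (leqnn D) (mlen_le alpha)) DK)
  (symbol_leq (leq_add (leqnn s) (mlen_le alpha)) Sq).
have wle (alpha : mindex d n) : (weight B (mcomp alpha) <= M)%N.
  by have [->|/weight_lt/ltnW//] := eqVneq alpha alpha0; rewrite weight_alpha0.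
split; last first.
  apply/funext => x; rewrite /diff_op /realize.
  under eq_bigr do rewrite (H _).2 /realize mulr_sumr.
  rewrite exchange_big /=; apply: eq_bigr => j _.
  rewrite /symbol_op raddf_sum /= mulr_suml mulr_sumr; apply: eq_bigr => alpha _.
  by rewrite mevalZ mulrCA !mulrA.
split.
- move=> b; rewrite [X in CkC _ X](_ : _ = fun x => \sum_(alpha : mindex d n) (p alpha x)%:C%C *
      mcoeff b (symbol_mpderiv K alpha q x)).
    apply: CkC_sum => alpha; apply: CkCM; first exact: CkC_real.
    by have [[]] := H alpha.
  by apply/funext => x; rewrite raddf_sum /=; apply: eq_bigr => alpha _; rewrite mcoeffZ.
- move=> x b bD; rewrite raddf_sum big1 //= => alpha _.
  have [[_ h _ _] _] := H alpha; rewrite mcoeffZ h ?mulr0 //.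
  by apply: leq_ltn_trans bD; rewrite leq_add2l mlen_le.
- move=> x b bD; rewrite raddf_sum big1 //= => alpha _.
  have [[_ _ h _] _] := H alpha; rewrite mcoeffZ h ?mulr0 //.
  by apply: leq_ltn_trans bD; rewrite leq_add2l wle.
- move=> x; rewrite power_subst_sum coef_sum (bigD1 alpha0) //= big1 ?addr0.
    have [[_ _ _ h] _] := H alpha0.
    by rewrite power_substZ coefZ -h weight_alpha0.
  move=> alpha ne; have [[_ _ h _] _] := H alpha.
  by rewrite power_substZ coefZ (power_subst_coef_gt x h) ?mulr0 // ltn_add2l weight_lt.
Qed.

Lemma symbol_cst1 s : symbol B s 0 0 (fun _ : 'rV[R]_d => 1) (fun=> 1).
Proof.
have h (B' : 'I_d -> nat) : weight_le B' 0 (fun _ : 'rV[R]_d => 1).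
  move=> x b bN; rewrite mcoeff1; case: eqP => // e; move: bN.
  by rewrite e /weight big1 // => l _; rewrite mnm0E muln0.
split => //.
- by move=> b; exact: CkC_cst.
- by move=> x; rewrite /power_subst rmorph1 coef1.
Qed.

Lemma symbol_iter_op w k s :
  (forall alpha, Ck (s + k * n) (p alpha)) -> (k * n <= K)%N ->
  symbol B s (k * n) (k * M) (fun x => ((p alpha0 x)%:C%C) ^+ k)
    (iter k (symbol_op K p) (fun=> 1)) /\
  iter k (diff_op p) (realize v w (fun=> 1)) =
  realize v w (iter k (symbol_op K p) (fun=> 1)).
Proof.
elim: k s => [|k IH] s Cp kK.
  by split => //; rewrite !mul0n; exact: symbol_cst1.
rewrite mulSn in Cp kK.
have [||Sk ek] := IH (s + n)%N.
- by move=> alpha; rewrite -addnA.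
- by apply: leq_trans kK; rewrite leq_addl.
rewrite !iterS ek !mulSn [(n + _)%N]addnC [(M + _)%N]addnC.
under [X in symbol _ _ _ _ X _]eq_fun do rewrite exprS.
apply: symbol_opP Sk => //; last by rewrite addnC.
by move=> alpha; apply: Ck_leq (Cp alpha); rewrite leq_addr.
Qed.

(** Each of the [k] applications of the operator, of order at most [n], lowers
    the number of available derivatives by [n], and [alpha] by at most [n] more;
    [k.+1 * n] derivatives of the coefficients cover this. *)
Lemma symbol_SmatrixP w k (alpha : mindex d n) :
  (forall beta, Ck (k.+1 * n) (p beta)) -> (k.+1 * n <= K)%N ->
  symbol B 0 (k * n + mlen alpha) (k * M + weight B (mcomp alpha))
    (fun x => ((p alpha0 x)%:C%C) ^+ k)
    (symbol_mpderiv K alpha (iter k (symbol_op K p) (fun=> 1))) /\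
  mpderiv alpha (iter k (diff_op p) (realize v w (fun=> 1))) =
  realize v w (symbol_mpderiv K alpha (iter k (symbol_op K p) (fun=> 1))).
Proof.
move=> Cp; rewrite mulSn => kK; have ln := mlen_le alpha.
have [||Sk ->] := symbol_iter_op w (k := k) (s := mlen alpha).
- by move=> beta; apply: Ck_leq (Cp beta); rewrite mulSn leq_add2r.
- by apply: leq_trans kK; rewrite leq_addl.
apply: (symbol_mpderivP (s := 0%N) v w B_gt0 _ Sk).
by rewrite addnC; apply: leq_trans kK; rewrite leq_add2r.
Qed.

End SymbolOp.

(** * Nonvanishing of the determinant at a fixed point *)

Lemma mcomp_inj (d n : nat) (alpha beta : mindex d n) :
  mcomp alpha =1 mcomp beta -> alpha = beta.
Proof. by move=> e; apply/val_inj/mnmP. Qed.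

Lemma mcomp_le (d n : nat) (alpha : mindex d n) (l : 'I_d) : (mcomp alpha l <= n)%N.
Proof.
apply: leq_trans (mlen_le alpha); rewrite /mlen mdegE (bigD1 l) //=.
exact: leq_addr.
Qed.

Lemma mindex_of_inj (d n : nat) : injective (@mindex_of d n).
Proof. by move=> a b /enum_val_inj /cast_ord_inj. Qed.

(** A multi-index of length [n] concentrated on the variable [j] has the largest
    weight [n * B j] among those of length at most [n], because [B j] is the largest
    of the weights, and no other one reaches it, because weights separate. *)
Lemma exists_weight_diag (d n : nat) (alpha0 : mindex d n) :
  alpha0 \in diag_mindex d n ->
  exists B : 'I_d -> nat,
    [/\ forall l, (0 < B l)%N,
        injective (fun alpha : mindex d n => weight B (mcomp alpha)),
        forall alpha : mindex d n, alpha != alpha0 ->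
          (weight B (mcomp alpha) < weight B (mcomp alpha0))%N &
        (n <= weight B (mcomp alpha0))%N].
Proof.
rewrite inE => /andP[_ /existsP[j /eqP jn]].
have [B [Bj Binj]] := exists_separating_weight n j.
have winj : injective (fun alpha : mindex d n => weight B (mcomp alpha)).
  by move=> alpha beta /(Binj _ _ (mcomp_le alpha) (mcomp_le beta)) /mcomp_inj.
have B0 l : (0 < B l)%N by case/andP: (Bj l).
have top : (B j * n <= weight B (mcomp alpha0))%N.
  by rewrite /weight (bigD1 j) //= jn leq_addr.
exists B; split => // [alpha ne|].
  rewrite ltn_neqAle (contra_neq (@winj _ _) ne) /=; apply: leq_trans top.
  apply: (@leq_trans (B j * mlen alpha)); last by rewrite leq_mul2l mlen_le orbT.
  rewrite /weight /mlen mdegE big_distrr /=; apply: leq_sum => l _.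
  by rewrite leq_mul2r; case/andP: (Bj l) => _ ->; rewrite orbT.
by apply: leq_trans top; rewrite leq_pmull.
Qed.

Lemma expi_neq0 (R : realType) (t : R) : expi t != 0.
Proof.
apply/eqP => -[c0 s0]; have := cos2Dsin2 t.
by rewrite c0 s0 expr0n /= addr0 => /eqP; rewrite eq_sym oner_eq0.
Qed.

Section NonvanishingDeterminant.
Variables (R : realType) (d n r : nat) (p : mindex d n -> 'rV[R]_d -> R).
Variable zeta : 'I_r -> 'rV[int]_d.
Local Notation m := 'C(n + d, d).
Hypothesis p_Ck : forall alpha : mindex d n, Ck (m * n) (p alpha).

Definition frequency (j : 'I_r) (l : 'I_d) : R := (zeta j ord0 l)%:~R.

(** The row [k] counts from 0, so it involves [k] applications of the operator. *)
Definition entry_symbol (k a : 'I_m) : 'rV[R]_d -> mpoly d R[i] :=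
  symbol_mpderiv (m * n) (mindex_of a) (iter k (symbol_op (m * n) p) (fun=> 1)).

Definition entry_coef (x : 'rV[R]_d) (k a : 'I_m) (j : 'I_r) : R[i] :=
  meval (fun l => 'i%C * (frequency j l)%:C%C) (entry_symbol k a x)
  * expi (phase (frequency j) x).

Lemma entry_symbolP (B : 'I_d -> nat) (alpha0 : mindex d n) w (k a : 'I_m) :
  (forall l, 0 < B l)%N ->
  (forall alpha : mindex d n, alpha != alpha0 ->
      (weight B (mcomp alpha) < weight B (mcomp alpha0))%N) ->
  symbol B 0 (k * n + mlen (mindex_of a))
    (k * weight B (mcomp alpha0) + weight B (mcomp (mindex_of a)))
    (fun x => ((p alpha0 x)%:C%C) ^+ k) (entry_symbol k a) /\
  mpderiv (mindex_of a) (iter k (diff_op p) (realize frequency w (fun=> 1))) =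
  realize frequency w (entry_symbol k a).
Proof.
move=> B0 Blt; apply: symbol_SmatrixP => //.
  by move=> beta; apply: Ck_leq (p_Ck beta); rewrite leq_mul2r ltn_ord orbT.
by rewrite leq_mul2r ltn_ord orbT.
Qed.

Lemma entry_degree_le (k a : 'I_m) : (k * n + mlen (mindex_of a) <= m * n)%N.
Proof.
apply: (@leq_trans (k.+1 * n)); last by rewrite leq_mul2r ltn_ord orbT.
by rewrite mulSn addnC leq_add2r mlen_le.
Qed.

(** The symbols in row [k] and column [a] have weighted degree [g k + v a] and a
    power of [p alpha0 x] as leading coefficient, so some functional is invertible
    on them. It is a combination of evaluations at the points [i zeta_j], and the
    weights absorb the nonzero values of the plane waves at [x]. *)
Lemma exists_det_neq0 (x : 'rV[R]_d) (alpha0 : mindex d n) :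
  ~ on_hypersurface (m * n) frequency ->
  alpha0 \in diag_mindex d n -> p alpha0 x != 0 ->
  exists w : 'I_r -> R[i],
    \det (\matrix_(k, a) \sum_(j < r) w j * entry_coef x k a j) != 0.
Proof.
move=> nh diag0 p0; have [B [B0 winj Blt nB]] := exists_weight_diag diag0.
set M := weight B (mcomp alpha0) in Blt nB.
pose f (k a : 'I_m) := power_subst B (entry_symbol k a x).
pose g (k : 'I_m) : nat := (k * M)%N.
pose v (a : 'I_m) : nat := weight B (mcomp (mindex_of a)).
have S k a := (entry_symbolP (alpha0 := alpha0) (fun=> 0) k a B0 Blt).1.
have szf k a : size (f k a) = (g k + v a).+1.
  have [_ _ h t] := S k a; apply/eqP; rewrite eqn_leq size_power_subst_le //=; last exact: h.
  rewrite ltnNge; apply/negP => sz; have /eqP := t x; rewrite -/(f k a) nth_default //.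
  by rewrite eq_sym expf_eq0 => /andP[_]; apply/negP; rewrite (inj_eq (@complexI R)).
have v_le a : (v a <= M)%N.
  by have [e|/Blt/ltnW//] := eqVneq (mindex_of a) alpha0; rewrite /v e.
have gmono (k k' : 'I_m) : (k < k')%N -> (g k < g k')%N.
  move=> kk'; rewrite /g ltn_mul2r kk' andbT; apply: leq_trans nB.
  rewrite lt0n; apply/eqP => n0.
  (* For n = 0 all weights vanish, but then the matrix has a single row. *)
  have m1 : m = 1%N by rewrite n0 add0n binn.
  by have := ltn_ord k'; rewrite [X in (_ < X)%N]m1; case: (nat_of_ord k') kk'.
have fT k a : (size (f k a) <= (m * M + M).+1)%N.
  by rewrite szf ltnS leq_add ?v_le // leq_mul2r (ltnW (ltn_ord k)) orbT.
have vinj : injective v by move=> a b /winj /mindex_of_inj.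
have [lam detlam] := exists_functional_det_neq0 gmono vinj szf fT.
have i0 : 'i%C != 0 :> R[i] by rewrite complexiE neq0Ci.
have [c cP] := @functional_by_points _ _ (real_complex R) 'i%C d r (m * n) frequency
  (fun b : mindex d (m * n) => coef_functional (m * M + M).+1 lam 'X^(weight B (mcomp b)))
  i0 nh.
exists (fun j => c j / expi (phase (frequency j) x)).
congr (\det _ != 0): detlam; apply/matrixP => k a; rewrite !mxE.
have [_ dg _ _] := S k a; have sz := msize_weight_le x dg (entry_degree_le k a).
rewrite (coef_functional_power_subst _ _ _ sz) -cP //; apply: eq_bigr => j _.
by rewrite /entry_coef mulrCA mulfVK ?expi_neq0 // mulrC.
Qed.

End NonvanishingDeterminant.

Lemma Smatrix_entry (R : realType) (d n r : nat) (p : mindex d n -> 'rV[R]_d -> R)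
    (zeta : 'I_r -> 'rV[int]_d) (w : 'I_r -> R) (x : 'rV[R]_d) (alpha0 : mindex d n) :
  (forall alpha : mindex d n, Ck ('C(n + d, d) * n) (p alpha)) ->
  alpha0 \in diag_mindex d n ->
  Smatrix p (initial_data zeta w) x =
  \matrix_(k, a) \sum_(j < r) (w j)%:C%C * entry_coef p zeta x k a j.
Proof.
move=> Cp /exists_weight_diag[B [B0 _ Blt _]].
apply/matrixP => k a; rewrite !mxE.
have -> : initial_data zeta w = realize (frequency R zeta) (fun j => (w j)%:C%C) (fun=> 1).
  by apply/funext => y; apply: eq_bigr => j _; rewrite meval1 mul1r.
by rewrite (entry_symbolP zeta Cp _ k a B0 Blt).2.
Qed.

(** * Measurability *)

Section TupleMeasurability.
Variables (R : realType) (d : nat).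
Local Notation RR := (measurableTypeR R).

(** The lattice of mesh [1 / k.+1]: [grid_index k t] is the cell containing [t] and
    [grid_point k z] its lower corner. *)
Definition grid_point (k : nat) (z : {ffun 'I_d -> int}) : 'rV[R]_d :=
  \row_j ((z j)%:~R / k.+1%:R).

Definition grid_index (k : nat) (t : d.-tuple RR) : {ffun 'I_d -> int} :=
  [ffun j => Num.floor (tnth t j * k.+1%:R : R)].

Lemma measurable_grid_cell (k : nat) (z : {ffun 'I_d -> int}) :
  measurable [set t | grid_index k t = z].
Proof.
rewrite [X in measurable X](_ : _ =
    \big[setI/setT]_(j < d) ((fun t : d.-tuple RR => tnth t j) @^-1`
       `[(z j)%:~R / k.+1%:R, (z j + 1)%:~R / k.+1%:R[%classic)).
  apply: bigsetI_measurable => j _.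
  rewrite -[X in measurable X]setTI; apply: measurable_tnth => //.
apply/seteqP; split => t /=.
  move=> <-; rewrite -bigcap_seq /= => j _ /=.
  rewrite in_itv /= ffunE ler_pdivrMr // ltr_pdivlMr //.
  by rewrite floor_itv.
rewrite -bigcap_seq => h; apply/ffunP => j; rewrite ffunE.
apply: floor_def; have := h j (mem_index_enum _) => /=.
by rewrite in_itv /= ler_pdivrMr // ltr_pdivlMr.
Qed.

Lemma cvg_grid_point (t : d.-tuple RR) :
  grid_point k (grid_index k t) @[k --> \oo] --> torus_point t.
Proof.
apply/cvg_ballP => e e0.
near=> k; split => // i j; rewrite !mxE ffunE.
rewrite /ball /= ltr_norml.
have k0 : 0 < k.+1%:R :> R by [].
have ke : k.+1%:R^-1 < e by near: k; exact: (near_infty_natSinv_lt (PosNum e0)).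
set s : R := tnth t j.
have /andP[f1 f2] := floor_itv (s * k.+1%:R).
have g1 : (Num.floor (s * k.+1%:R))%:~R / k.+1%:R <= s by rewrite ler_pdivrMr.
have g2 : s < (Num.floor (s * k.+1%:R))%:~R / k.+1%:R + k.+1%:R^-1.
  by rewrite -[X in _ + X]mul1r -mulrDl ltr_pdivlMr // -[1]/(1%:~R) -intrD.
move: ke g1 g2; move: (_ / _) => q; move: (_^-1) => c ke g1 g2.
have ineq (e' s' q' c' : R) : 0 < e' -> c' < e' -> q' <= s' -> s' < q' + c' ->
    - e' < s' - q' < e' by move=> *; apply/andP; split; lra.
exact: (ineq e s q c).
Unshelve. all: by end_near.
Qed.

(** A continuous function is the pointwise limit of its values at the nearby
    lattice points, and those take countably many values on measurable cells. This
    relates the topology of row vectors to the product sigma-algebra of tuples. *)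
Lemma measurable_continuous_tuple (f : 'rV[R]_d -> R) :
  continuous f ->
  measurable_fun [set: d.-tuple RR] (fun t => f (torus_point t) : RR).
Proof.
move=> fc.
apply: (@measurable_realfun.measurable_fun_cvg _ _ _ _
  (fun k (t : d.-tuple RR) => f (grid_point k (grid_index k t)))).
  move=> k _ Y mY; rewrite setTI.
  rewrite [X in measurable X](_ : _ = \bigcup_(z : {ffun 'I_d -> int})
     (if f (grid_point k z) \in Y then [set t | grid_index k t = z] else set0)).
    apply: countable_bigcupT_measurable; first exact: countableP.
    by move=> z; case: ifPn => // _; exact: measurable_grid_cell.
  apply/seteqP; split => t /=.
    by move=> Yt; exists (grid_index k t) => //; rewrite mem_set.
  by case=> z _; case: ifPn => // /set_mem Yz /= ->.
move=> t _; apply: (cvg_comp _ f (cvg_grid_point (t := t))).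
exact: fc.
Qed.

End TupleMeasurability.

Section ComplexMeasurable.
Context {disp : measure_display} {T : measurableType disp} {R : realType}.
Implicit Types f g : T -> R[i].

Definition cmeasurable f : Prop :=
  measurable_fun [set: T] (fun t => complex.Re (f t) : measurableTypeR R) /\
  measurable_fun [set: T] (fun t => complex.Im (f t) : measurableTypeR R).

Lemma cmeasurable_cst (c : R[i]) : cmeasurable (fun=> c).
Proof. by split; exact: measurable_cst. Qed.

Lemma cmeasurableD f g : cmeasurable f -> cmeasurable g ->
  cmeasurable (fun t => f t + g t).
Proof.
move=> [f1 f2] [g1 g2]; split.
- rewrite (_ : (fun t => _) = (fun t => complex.Re (f t) + complex.Re (g t))); last first.
    by apply/funext => t; case: (f t); case: (g t).
  exact: measurable_realfun.measurable_funD.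
- rewrite (_ : (fun t => _) = (fun t => complex.Im (f t) + complex.Im (g t))); last first.
    by apply/funext => t; case: (f t); case: (g t).
  exact: measurable_realfun.measurable_funD.
Qed.

Lemma cmeasurableM f g : cmeasurable f -> cmeasurable g ->
  cmeasurable (fun t => f t * g t).
Proof.
move=> [f1 f2] [g1 g2]; split.
- rewrite (_ : (fun t => _) = (fun t => complex.Re (f t) * complex.Re (g t)
                                      - complex.Im (f t) * complex.Im (g t))); last first.
    by apply/funext => t; case: (f t); case: (g t).
  by apply: measurable_realfun.measurable_funB; exact: measurable_realfun.measurable_funM.
- rewrite (_ : (fun t => _) = (fun t => complex.Re (f t) * complex.Im (g t)
                                      + complex.Im (f t) * complex.Re (g t))); last first.
    by apply/funext => t; case: (f t); case: (g t).
  by apply: measurable_realfun.measurable_funD; exact: measurable_realfun.measurable_funM.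
Qed.

Lemma cmeasurable_sum (I : Type) (s : seq I) (P : pred I) (F : I -> T -> R[i]) :
  (forall i, cmeasurable (F i)) -> cmeasurable (fun t => \sum_(i <- s | P i) F i t).
Proof.
move=> h; elim: s => [|i s IH].
  under [X in cmeasurable X]eq_fun do rewrite big_nil.
  exact: cmeasurable_cst.
under [X in cmeasurable X]eq_fun do rewrite big_cons.
by case: (P i) => //; exact: cmeasurableD.
Qed.

Lemma cmeasurable_prod (I : Type) (s : seq I) (P : pred I) (F : I -> T -> R[i]) :
  (forall i, cmeasurable (F i)) -> cmeasurable (fun t => \prod_(i <- s | P i) F i t).
Proof.
move=> h; elim: s => [|i s IH].
  under [X in cmeasurable X]eq_fun do rewrite big_nil.
  exact: cmeasurable_cst.
under [X in cmeasurable X]eq_fun do rewrite big_cons.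
by case: (P i) => //; exact: cmeasurableM.
Qed.

Lemma cmeasurable_det (m : nat) (A : T -> 'M[R[i]]_m) :
  (forall k a, cmeasurable (fun t => A t k a)) -> cmeasurable (fun t => \det (A t)).
Proof.
move=> h; rewrite /determinant; apply: cmeasurable_sum => s.
apply: cmeasurableM; first exact: cmeasurable_cst.
by apply: cmeasurable_prod => i; exact: h.
Qed.

Lemma measurable_zeros f : cmeasurable f -> measurable [set t | f t = 0].
Proof.
move=> [f1 f2]; rewrite (_ : [set t | _] =
    ((fun t => complex.Re (f t) : measurableTypeR R) @^-1` [set 0]) `&`
    ((fun t => complex.Im (f t) : measurableTypeR R) @^-1` [set 0])); last first.
  by apply/seteqP; split => t /=; case: (f t) => x y /=; [case=> -> ->|case=> -> ->].
apply: measurableI; rewrite -[X in measurable X]setTI.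
  by apply: f1 => //; exact: measurable_set1.
by apply: f2 => //; exact: measurable_set1.
Qed.

End ComplexMeasurable.

Lemma cmeasurable_comp (d1 d2 : measure_display) (T1 : measurableType d1)
    (T2 : measurableType d2) (R : realType) (f : T2 -> R[i]) (h : T1 -> T2) :
  cmeasurable f -> measurable_fun setT h -> cmeasurable (fun t => f (h t)).
Proof.
move=> [f1 f2] mh.
by split; [exact: measurableT_comp f1 mh|exact: measurableT_comp f2 mh].
Qed.

(** * Null sets of product measures *)

Lemma product_measure_null (d1 d2 : measure_display) (T1 : measurableType d1)
    (T2 : measurableType d2) (R : realType) (m1 : probability T1 R)
    (m2 : probability T2 R) (Z : set (T1 * T2)) :
  measurable Z -> {ae m1, forall x, m2 (xsection Z x) = 0%E} ->
  (m1 \x m2)%E Z = 0%E.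
Proof.
move=> mZ h; rewrite /product_measure1.
rewrite (@ge0_ae_eq_integral _ _ _ m1 setT _ (cst 0%E)) //.
- exact: integral0.
- exact: measurable_fun_xsection.
- by apply: filterS h => x h _.
Qed.

Lemma negligible_seq (R : realType) (P : probability (measurableTypeR R) R) (s : seq R) :
  (forall t, P [set t] = 0%E) -> P.-negligible [set t | t \in s].
Proof.
move=> P0; elim: s => [|x s IH].
  rewrite [X in P.-negligible X](_ : _ = set0); first exact: negligible_set0.
  by apply/seteqP; split.
apply: (@negligibleS _ _ _ P ([set x] `|` [set t | t \in s])).
  by move=> t /=; rewrite inE => /orP[/eqP ->|]; [left|right].
apply: negligibleU; last exact: IH.
by apply/negligibleP; [exact: measurable_set1|exact: P0].
Qed.

Lemma real_roots_finite (R : realType) (P : {poly R[i]}) : P != 0 ->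
  exists s : seq R, forall t : R, P.[t%:C%C] = 0 -> t \in s.
Proof.
move=> P0; have [rs e] := closed_field_poly_normal P.
exists (map (@complex.Re R) rs) => t Pt.
have : root P t%:C%C by apply/rootP.
rewrite e rootZ ?lead_coef_eq0 // root_prod_XsubC => h.
by rewrite -[t]/(complex.Re t%:C%C) map_f.
Qed.

Definition fun_cons (T : Type) (r : nat) (t : T) (w : 'I_r -> T) (j : 'I_r.+1) : T :=
  if unlift ord0 j is Some i then w i else t.

(** A polynomial dependence on each variable separately is all that the zero set
    argument uses, and it is stable under fixing a variable. *)
Definition separately_polynomial (F : fieldType) (r : nat) (f : ('I_r -> F) -> F) : Prop :=
  forall (j : 'I_r) (w : 'I_r -> F), exists P : {poly F},
    forall t, f (fun i => if i == j then t else w i) = P.[t].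

Lemma fun_consE (T : Type) (r : nat) (w : 'I_r.+1 -> T) :
  fun_cons (w ord0) (fun i => w (lift ord0 i)) = w.
Proof. by apply/funext => j; rewrite /fun_cons; case: unliftP => [i|] ->. Qed.

Lemma separately_polynomial_cons (F : fieldType) (r : nat) (f : ('I_r.+1 -> F) -> F) (t : F) :
  separately_polynomial f -> separately_polynomial (fun w => f (fun_cons t w)).
Proof.
move=> h j w; have [P hP] := h (lift ord0 j) (fun_cons t w).
exists P => s; rewrite -hP; congr f; apply/funext => i.
by rewrite /fun_cons; case: unliftP => [k|] ->.
Qed.

(** By induction on the number of variables: in the first variable, with the
    others as in [w0], [f] is a nonzero polynomial, so away from finitely many real values,
    which form a null set, the function of the other variables is again not
    identically zero. The witness [w0] may be complex while the zero set only
    involves real points. *)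
Lemma product_prob_null (R : realType) (r : nat)
    (P : 'I_r -> probability (measurableTypeR R) R)
    (f : ('I_r -> R[i]) -> R[i]) (w0 : 'I_r -> R[i])
    (Z : set (r.-tuple (measurableTypeR R))) :
  (forall j t, P j [set t] = 0%E) -> separately_polynomial f -> f w0 != 0 ->
  measurable Z -> (forall t, Z t -> f (fun j => (weights t j)%:C%C) = 0) ->
  product_prob P Z = 0%E.
Proof.
elim: r P f w0 Z => [|r IH] P f w0 Z P0 sf f0 mZ Zf.
  rewrite (_ : Z = set0) ?measure0 //; apply/seteqP; split => // t /Zf e.
  by case/eqP: f0; rewrite -e; congr f; apply/funext => -[].
rewrite /= /distribution /pushforward.
apply: product_measure_null.
  by rewrite -[X in measurable X]setTI; exact: (@measurable_tuple_cons _ _ r).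
have [Q hQ] := sf ord0 w0.
have Q0 : Q != 0.
  apply: contraNneq f0 => Q0; rewrite -[w0](fun_consE w0).
  have := hQ (w0 ord0); rewrite Q0 horner0 => e; apply/eqP; rewrite -{}e; congr f.
  by apply/funext => i; rewrite fun_consE; case: eqP => [->|].
have [s hs] := real_roots_finite Q0.
apply: (@negligibleS _ _ _ (P ord0) [set t | t \in s]); last first.
  exact: negligible_seq.
move=> t /= ht; apply: hs; apply: contrapT => /eqP Qt; apply: ht.
apply: (IH _ (fun w => f (fun_cons t%:C%C w)) (fun i => w0 (lift ord0 i))) => //.
- exact: separately_polynomial_cons.
- move: Qt; rewrite -hQ; congr (f _ != 0); apply/funext => i.
  by rewrite /fun_cons; case: unliftP => [k|] -> //; rewrite eqxx.
- apply: measurable_xsection.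
  by rewrite -[X in measurable X]setTI; exact: (@measurable_tuple_cons _ _ r).
- move=> w; rewrite /xsection /= inE /= => /Zf <-; congr f; apply/funext => i.
  rewrite /fun_cons /weights; case: unliftP => [k|] -> //=.
  by rewrite tnthS.
Qed.

Lemma uniform_prob_set1 (R : realType) (a b : R) (ab : a < b) (t : R) :
  uniform_prob ab [set t] = 0%E.
Proof.
have /null_content_dominatesP h := dominates_uniform_prob ab.
by apply: h => //; exact: lebesgue_measure_set1.
Qed.

(** With all variables but one fixed, this is the determinant of a matrix of
    polynomials in that variable, evaluated at its value. *)
Lemma separately_polynomial_det (F : fieldType) (r m : nat)
    (s : 'I_m -> 'I_m -> 'I_r -> F) :
  separately_polynomial (fun w => \det (\matrix_(k, a) \sum_(j < r) w j * s k a j)).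
Proof.
move=> j w.
pose A : 'M[{poly F}]_m := \matrix_(k, a)
  \sum_(i < r) (if i == j then 'X else (w i)%:P) * (s k a i)%:P.
exists (\det A) => t; rewrite -horner_evalE -det_map_mx; congr (\det _).
apply/matrixP => k a; rewrite !mxE raddf_sum /=; apply: eq_bigr => i _.
by rewrite horner_evalE hornerM hornerC; case: eqP => _; rewrite ?hornerX ?hornerC.
Qed.

(** * The theorem *)

(** The symbols have continuous coefficients, since the entries of the matrix
    involve at most as many derivatives as the operator has to offer, and plane
    waves are continuous. *)
Lemma cmeasurable_entry_coef (R : realType) (d n r : nat) (p : mindex d n -> 'rV[R]_d -> R)
    (zeta : 'I_r -> 'rV[int]_d) (alpha0 : mindex d n) k a j :
  (forall alpha : mindex d n, Ck ('C(n + d, d) * n) (p alpha)) ->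
  alpha0 \in diag_mindex d n ->
  cmeasurable (fun t : d.-tuple (measurableTypeR R) =>
    entry_coef p zeta (torus_point t) k a j).
Proof.
move=> Cp /exists_weight_diag[B [B0 _ Blt _]].
have [[Cq Dq _ _] _] := entry_symbolP zeta Cp (fun=> 0) k a B0 Blt.
apply: cmeasurableM.
  under [X in cmeasurable X]eq_fun do
    rewrite (meval_sum_bounded _ (msize_weight_le _ Dq (entry_degree_le k a))).
  apply: cmeasurable_sum => b; apply: cmeasurableM; last exact: cmeasurable_cst.
  by have [[c1 _] [c2 _]] := Cq b; split;
    [exact: (measurable_continuous_tuple c1)|exact: (measurable_continuous_tuple c2)].
have phase_c : continuous (phase (frequency R zeta j)).
  apply: (@continuous_big _ _ _ _ _ add_continuous _ _
    (fun l (x : 'rV[R]_d) => frequency R zeta j l * x ord0 l)) => l _ x.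
  have c1 : continuous (fun _ : 'rV[R]_d => frequency R zeta j l)
    by exact: cst_continuous.
  have c2 : continuous (fun y : 'rV[R]_d => y ord0 l) by exact: coord_continuous.
  exact: (cvgM (c1 x) (c2 x)).
split.
- apply: (measurable_continuous_tuple (f := cos \o phase (frequency R zeta j))) => x.
  by apply: continuous_comp; [exact: phase_c|exact: continuous_cos].
- apply: (measurable_continuous_tuple (f := sin \o phase (frequency R zeta j))) => x.
  by apply: continuous_comp; [exact: phase_c|exact: continuous_sin].
Qed.

Theorem theorem3p5 (R : realType) (d n r : nat)
    (p : mindex d n -> 'rV[R]_d -> R)
    (zeta : 'I_r -> 'rV[int]_d)
    (a b : 'I_r -> R) (ab : forall j : 'I_r, a j < b j) :
  let m := 'C(n + d, d) in
  (forall alpha : mindex d n, torus_periodic (p alpha)) ->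
  (forall alpha : mindex d n, Ck (m * n) (p alpha)) ->
  ('C(m * n + d, d) < r)%N ->
  ~ on_hypersurface (m * n) (fun j l => (zeta j ord0 l)%:~R : R) ->
  {ae torus_prob R d, forall x,
     \sum_(alpha in diag_mindex d n) `|p alpha (torus_point x)| ^+ 2 != 0} ->
  {ae (torus_prob R d \x weights_prob ab)%E, forall xw,
     Smatrix p (initial_data zeta (weights xw.2)) (torus_point xw.1) \in unitmx}.
Proof.
move=> m _ Cp _ nh ellip.
(* In a probability space an almost sure property holds somewhere, and an
   empty sum cannot be nonzero. *)
have [alpha0 diag0] : exists alpha, alpha \in diag_mindex d n.
  apply: contrapT => no_diag.
  have /negligibleP : (torus_prob R d).-negligible setT.
    apply: negligibleS ellip => x _ /=; rewrite big1 ?eqxx // => alpha da.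
    by case: no_diag; exists alpha.
  move=> /(_ measurableT) e; have := probability_setT (torus_prob R d).
  by move=> /(etrans (esym e))/eqP; rewrite eqe eq_sym oner_eq0.
pose Sdet (xw : d.-tuple (measurableTypeR R) * r.-tuple (measurableTypeR R)) : R[i] :=
  \det (\matrix_(k, l) \sum_(j < r) (weights xw.2 j)%:C%C *
     entry_coef p zeta (torus_point xw.1) k l j).
have mdet : measurable [set xw | Sdet xw = 0].
  apply: measurable_zeros; apply: cmeasurable_det => k l.
  under [X in cmeasurable X]eq_fun do rewrite mxE.
  apply: cmeasurable_sum => j; apply: cmeasurableM.
    split; last exact: measurable_cst.
    exact: (measurableT_comp (measurable_tnth j) measurable_snd).
  exact: (cmeasurable_comp (cmeasurable_entry_coef _ _ _ _ Cp diag0) measurable_fst).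
apply: (@negligibleS _ _ _ _ [set xw | Sdet xw = 0]).
  move=> xw /= h; apply: contrapT => /eqP nz; apply: h.
  by rewrite unitmxE (Smatrix_entry _ _ _ Cp diag0) unitfE.
apply/negligibleP => //.
apply: product_measure_null => //.
apply: filterS ellip => x sx.
have [alpha1 diag1 p1] : exists2 alpha, alpha \in diag_mindex d n & p alpha (torus_point x) != 0.
  apply: contrapT => no; case/eqP: sx; apply: big1 => alpha da.
  have [->|pa] := eqVneq (p alpha (torus_point x)) 0; first by rewrite normr0 expr0n.
  by case: no; exists alpha.
have [w0 w0P] := exists_det_neq0 Cp nh diag1 p1.
apply: (product_prob_null (f := fun w => \det (\matrix_(k, l)
  \sum_(j < r) w j * entry_coef p zeta (torus_point x) k l j)) _ _ w0P).
- by move=> j t; exact: uniform_prob_set1.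
- exact: separately_polynomial_det.
- exact: measurable_xsection.
- by move=> w; rewrite /xsection /= inE.
Qed.
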